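(* Let $k\ge 3$ be a fixed integer and let $t_k(m,n)$ denote the number of $k$-threshold functions on $\mathcal{G}_{m,n}=\{0,\dots,m-1\}\times\{0,\dots,n-1\}$. As $\min(m,n)\to\infty$: if $k$ is even, then $$t_k(m,n)\le \frac{5^k}{12^{k/2}\,\pi^{2k}\,(k/2)!}\,m^{2k}n^{2k}+o(m^{2k}n^{2k});$$ if $k$ is odd, then $$t_k(m,n)\le \frac{5^{k-1}\cdot 6}{12^{\lfloor k/2\rfloor}\,\pi^{2k}\,\lfloor k/2\rfloor!\,k}\,m^{2k}n^{2k}+o(m^{2k}n^{2k}).$$
   Context: For positive integers $m,n$ let $\mathcal{G}_{m,n}=\{0,\dots,m-1\}\times\{0,\dots,n-1\}\subset\mathbb{Z}^2$. For $f:\mathcal{G}_{m,n}\to\{0,1\}$ and $\nu\in\{0,1\}$ let $M_\nu(f)=\{x\in\mathcal{G}_{m,n}: f(x)=\nu\}$. The function $f$ is threshold if $\mathrm{Conv}(M_0(f))\cap\mathrm{Conv}(M_1(f))=\emptyset$, where $\mathrm{Conv}$ is the convex hull in $\mathbb{R}^2$ (with $\mathrm{Conv}(\emptyset)=\emptyset$, so constant functions are threshold). The function $f$ is $k$-threshold if there exist at most $k$ threshold functions on $\mathcal{G}_{m,n}$ such that $M_1(f)$ is the intersection of their sets $M_1(\cdot)$. *)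

(* Defs.v *)
From mathcomp Require Import all_boot all_order all_algebra.
From mathcomp Require Import all_classical all_reals all_analysis.
Import Order.TTheory GRing.Theory Num.Theory.
Import numFieldNormedType.Exports.

Set Implicit Arguments.
Unset Strict Implicit.
Unset Printing Implicit Defensive.

Local Open Scope classical_set_scope.
Local Open Scope ring_scope.

Notation grid m n := ('I_m * 'I_n)%type.

Definition grid_point (R : realType) (m n : nat) (x : grid m n) : R^o * R^o :=
  (x.1%:R, x.2%:R).

(* [smallest C A] is the intersection of all sets satisfying [C] that contain
   [A]; the empty set is convex, so the hull of the empty set is empty. *)
Definition convex_hull (R : realType) (A : set (R^o * R^o)) :
    set (R^o * R^o) :=
  smallest (fun C : set (R^o * R^o) => convex_set C) A.

Definition level_set (m n : nat) (nu : bool) (f : {ffun grid m n -> bool}) :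
    set (grid m n) :=
  [set x | f x = nu].

Definition threshold (R : realType) (m n : nat)
    (f : {ffun grid m n -> bool}) : Prop :=
  convex_hull (@grid_point R m n @` level_set false f) `&`
    convex_hull (@grid_point R m n @` level_set true f) = set0.

Definition k_threshold (R : realType) (k m n : nat)
    (f : {ffun grid m n -> bool}) : Prop :=
  exists j : nat, (j <= k)%N /\
    exists g : 'I_j -> {ffun grid m n -> bool},
      (forall i, threshold R (g i)) /\
      level_set true f = \bigcap_(i in [set: 'I_j]) level_set true (g i).

Definition num_k_threshold (R : realType) (k m n : nat) : nat :=
  #|[set f : {ffun grid m n -> bool} | `[< k_threshold R k f >]]%SET|.

(* The filter on pairs (m, n) for "min(m, n) tends to infinity". *)
Notation min_infty := (filter_prod (\oo : set_system nat) (\oo : set_system nat)).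

(* Main.v *)
(** A conjunction [f] of [k] threshold functions that is not one of [k - 1] can
    be rewritten as a conjunction of half-planes: replace each function in turn
    by the side, containing the support of [f], of an inner tangent [A_i B_i]
    separating the points where [f] holds from those that only this function
    excludes.  Taking [A_i] and [B_i] closest on the tangent forces
    [A_i <> B_i] mod 2, since their midpoint would otherwise be closer.

    Then [f A_i] holds for all [i], so every [A_j] lies on the chosen side of
    [A_i B_i].  For fixed [A_i]'s the sets of admissible [B_i] are, up to lines,
    pairwise disjoint: if [B] were admissible for [i] and for [j], the triangle
    [A_i A_j B] would have both orientations.  They are also convex, so the
    parity condition removes a quarter of each.  By AM-GM there are at most
    [(3/4 * m n / k)^k] choices of the [B_i], hence about
    [(3/4)^k (m n)^(2k) / k^k] ordered [k]-tuples, that is,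
    [(3/4)^k / (k! k^k) * (m n)^(2k)] functions asymptotically.  This is
    strictly below the stated leading terms, so that the remainder can be
    chosen to vanish for large [min(m, n)]. *)

Require Import Defs.
From mathcomp Require Import all_boot all_order all_algebra.
From mathcomp Require Import all_fingroup.
From mathcomp Require Import all_classical all_reals all_analysis.
From mathcomp Require Import ring lra zify.
Import Order.TTheory GRing.Theory Num.Theory.
Import numFieldNormedType.Exports.

Set Implicit Arguments.
Unset Strict Implicit.
Unset Printing Implicit Defensive.

Local Open Scope classical_set_scope.
Local Open Scope ring_scope.

(** * Vectors ordered by direction *)

Definition cross (u v : int * int) : int := u.1 * v.2 - u.2 * v.1.

Definition dot (u v : int * int) : int := u.1 * v.1 + u.2 * v.2.

(** Lexicographic: [u] points strictly to the left of [v], or is parallel to [v] and reaches at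
    least as far along it. *)
Definition ahead (v u : int * int) : bool :=
  (0 < cross v u) || (cross v u == 0) && (dot v v <= dot v u).

(** The origin is not in the convex hull of [D]: by Carathéodory three vectors suffice in the plane,
    and nonnegative weights with sum at most 0 all vanish. *)
Definition pointed (D : {pred int * int}) : Prop :=
  forall u v w, u \in D -> v \in D -> w \in D ->
  forall a b c : int, 0 <= a -> 0 <= b -> 0 <= c ->
  a * u.1 + b * v.1 + c * w.1 = 0 -> a * u.2 + b * v.2 + c * w.2 = 0 ->
  a + b + c <= 0.

Lemma dot_gt0 (v : int * int) : v != 0 -> 0 < dot v v.
Proof.
case: v => x y nz; rewrite /dot /= lt0r paddr_eq0 ?sqr_ge0 ?addr_ge0 ?sqr_ge0//.
by rewrite !mulf_eq0 !orbb andbT; move: nz; rewrite -pair_eqE.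
Qed.

Lemma pointed_neq0 (D : {pred int * int}) v : pointed D -> v \in D -> v != 0.
Proof.
move=> Dp vD; apply/eqP => v0.
have := Dp v v v vD vD vD 1 0 0 ler01 (lexx 0) (lexx 0).
by rewrite v0 /= !mulr0 !addr0 => /(_ erefl erefl).
Qed.

(** If [w] is strictly to the right of [v] and [u] is not strictly to the left of [w], the three
    vectors combine positively to 0, against pointedness. If [w] is parallel to [v], pointedness
    makes the directions agree and lengths decide. *)
Lemma ahead_ind_step (v w u : int * int) (D : {pred int * int}) :
  pointed D -> v \in D -> w \in D -> u \in D ->
  ahead v u -> ~~ ahead v w -> ahead w u.
Proof.
move=> Dp vD wD uD; have v0 := dot_gt0 (pointed_neq0 Dp vD).
have w0 := dot_gt0 (pointed_neq0 Dp wD).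
rewrite /ahead negb_or -leNgt negb_and -ltNge => vu /andP[vw0 vw].
case: (ltrP (cross v w) 0) => vw_neg.
  have vu0 : 0 <= cross v u by case/orP: vu => [/ltW//|/andP[/eqP->]].
  apply/orP; left; rewrite ltNge; apply/negP => wu.
  (* The linear relation between three planar vectors, with cross products as coefficients; the last
     one is strictly positive. *)
  have := Dp v w u vD wD uD (- cross w u) (cross v u) (- cross v w).
  rewrite !oppr_ge0 wu vu0 (ltW vw_neg) => /(_ isT isT isT).
  rewrite /cross in wu vu0 vw_neg *.
  move=> /(_ ltac:(ring) ltac:(ring)); lra.
have {vw0 vw_neg} vw0 : cross v w = 0 by apply/eqP; rewrite eq_le vw0.
rewrite vw0 eqxx /= in vw.
have vw_gt0 : 0 < dot v w.
  rewrite ltNge; apply/negP => le0.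
  have := Dp v w w vD wD wD (- dot v w) (dot v v) 0.
  rewrite oppr_ge0 le0 (ltW v0) lexx => /(_ isT isT isT).
  have e1 : - dot v w * v.1 + dot v v * w.1 + 0 * w.1 = - (cross v w * v.2).
    by rewrite /dot /cross; ring.
  have e2 : - dot v w * v.2 + dot v v * w.2 + 0 * w.2 = cross v w * v.1.
    by rewrite /dot /cross; ring.
  rewrite e1 e2 vw0 !mul0r oppr0 => /(_ erefl erefl); lra.
(* These identities express products with [w] through products with [v], up to the positive factor
   [dot v v]. *)
have ewu : dot v v * cross w u = dot v w * cross v u - cross v w * dot v u.
  by rewrite /dot /cross; ring.
have edot : dot v v * dot w u = dot v w * dot v u + cross v w * cross v u.
  by rewrite /dot /cross; ring.
have eww : dot v v * dot w w = dot v w * dot v w + cross v w * cross v w.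
  by rewrite /dot /cross; ring.
rewrite vw0 mul0r subr0 in ewu; rewrite vw0 mul0r addr0 in edot.
rewrite vw0 mul0r addr0 in eww.
case/orP: vu => [vu|/andP[/eqP vu0 vu]].
  by apply/orP; left; rewrite -(pmulr_rgt0 _ v0) ewu mulr_gt0.
apply/orP; right; apply/andP; split.
  by rewrite -(inj_eq (mulfI (lt0r_neq0 v0))) ewu vu0 !mulr0.
rewrite -(ler_pM2l v0) edot eww. rewrite (ler_pM2l vw_gt0); exact: le_trans (ltW vw) vu.
Qed.

(* [ahead v u] orders the vectors of a pointed cone by direction, then by
   length, and this picks the first one. *)
Lemma ahead_min (D : seq (int * int)) :
  D != [::] -> pointed (mem D) ->
  exists2 v, v \in D & {in D, forall u, ahead v u}.
Proof.
have refl v : ahead v v by rewrite /ahead lexx andbT /cross [v.1 * _]mulrC subrr eqxx orbT.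
elim: D => // w [_ _ _|x D IH _ Dp].
  by exists w; rewrite ?mem_head // => u; rewrite inE => /eqP->.
have sub : {subset x :: D <= w :: x :: D} by move=> z zD; rewrite inE zD orbT.
have [||v vD vmin] := IH => //.
  by move=> u v' w' uD vD wD; apply: Dp; apply: sub.
have [vw|vw] := boolP (ahead v w).
  by exists v => [|u]; [exact: sub|rewrite inE => /predU1P[->|/vmin]].
exists w; rewrite ?mem_head // => u. rewrite inE => /predU1P[->//|uD].
apply: (ahead_ind_step Dp _ _ _ (vmin u uD) vw) => //; [exact: sub|exact: mem_head|exact: sub].
Qed.

(** For [v = A - B] and [u = t - B], the vector [v - u] is [A - t], so minimality of [v] puts [t]
    outside the half-plane. *)
Lemma ahead_sub (v u : int * int) :
  0 < dot v v -> ahead v (v - u) -> ~~ ahead v u.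
Proof.
rewrite /ahead => v0.
have -> : cross v (v - u) = - cross v u by rewrite /cross /=; ring.
have -> : dot v (v - u) = dot v v - dot v u by rewrite /dot /=; ring.
rewrite oppr_gt0 oppr_eq0 lerDl oppr_ge0.
case: (ltrgtP (cross v u) 0) => //= _ le0.
by rewrite -ltNge (le_lt_trans le0).
Qed.

(** Half of [v] has the direction of [v] and is shorter, so it comes strictly before [v]. *)
Lemma ahead_half (v u : int * int) : 0 < dot v v -> ahead v u -> u + u != v.
Proof.
move=> v0 vu; apply/eqP => uv; move: vu v0; rewrite /ahead -uv.
have -> : cross (u + u) u = 0 by rewrite /cross /=; ring.
have -> : dot (u + u) (u + u) = dot (u + u) u + dot (u + u) u.
  by rewrite /dot /=; ring.
by rewrite ltxx eqxx /= gerDl ltNge => d0; rewrite -oppr_ge0 opprD addr_ge0 ?oppr_ge0.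
Qed.

(** * Threshold functions and half-planes *)

Lemma convex_setP (R : realType) (C : set (R^o * R^o)) :
  convex_set C <-> forall (p q : R^o * R^o) (t : R), C p -> C q ->
    0 <= t -> t <= 1 ->
    C (t * p.1 + (1 - t) * q.1, t * p.2 + (1 - t) * q.2).
Proof.
split=> [Cc p q t Cp Cq t0 t1|H x y l].
  have := Cc p q (Itv01 t0 t1); rewrite !inE; exact.
rewrite !inE => Cx Cy; exact: H.
Qed.

Lemma convex_set3 (R : realType) (C : set (R^o * R^o)) (p q r : R^o * R^o)
    (a b c : R) :
  convex_set C -> C p -> C q -> C r -> 0 <= a -> 0 <= b -> 0 <= c ->
  0 < a + b + c ->
  C ((a * p.1 + b * q.1 + c * r.1) / (a + b + c),
     (a * p.2 + b * q.2 + c * r.2) / (a + b + c)).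
Proof.
move=> /convex_setP Cc Cp Cq Cr a0 b0 c0 abc.
have [ab0|ab0] := eqVneq (a + b) 0.
  have az : a = 0 by lra.
  have bz : b = 0 by lra.
  rewrite az bz !add0r !mul0r !add0r in abc *.
  by rewrite !(mulrC c) !mulfK ?gt_eqF // -surjective_pairing.
have ab : 0 < a + b by rewrite lt0r ab0 addr_ge0.
have frac (x y : R) : 0 <= x -> 0 <= y -> 0 < x + y ->
    0 <= x / (x + y) /\ x / (x + y) <= 1.
  move=> x0 y0 xy; split; first by rewrite divr_ge0 ?(ltW xy).
  by rewrite ler_pdivrMr // mul1r lerDl.
have [l0 l1] := frac _ _ a0 b0 ab; have [l0' l1'] := frac _ _ (ltW ab) c0 abc.
have := Cc _ r _ (Cc p q _ Cp Cq l0 l1) Cr l0' l1'.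
by rewrite /=; congr C; congr pair; field; rewrite !gt_eqF.
Qed.

Definition vec (m n : nat) (x : grid m n) : int * int := (x.1%:Z, x.2%:Z).

Section GridFunctions.
Variables m n : nat.
Implicit Types (A B x s t : grid m n) (f g : {ffun grid m n -> bool}).

(** For distinct [A] and [B]: the open side to the left of the line directed from [B] to [A], with
    the closed ray of that line from [A] away from [B]. *)
Definition halfplane A B : {ffun grid m n -> bool} :=
  [ffun x => ahead (vec A - vec B) (vec x - vec B)].

Definition diffs (S T : {pred grid m n}) : seq (int * int) :=
  [seq vec s - vec t | s <- enum S, t <- enum T].

(** The first difference [A - B] in the order [ahead] spans an inner tangent of [S] and [T]. A
    midpoint of [A] and [B] in [S] or [T] would produce half of [A - B] as an earlier difference. *)
Lemma halfplane_sep (S T : {pred grid m n}) (s0 t0 : grid m n) :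
  s0 \in S -> t0 \in T -> pointed (mem (diffs S T)) ->
  exists A B, [/\ A \in S, B \in T, {in S, forall s, halfplane A B s},
    {in T, forall t, ~~ halfplane A B t} &
    forall C, vec C + vec C = vec A + vec B -> C \notin S /\ C \notin T].
Proof.
move=> s0S t0T Dp.
have inD s t : s \in S -> t \in T -> vec s - vec t \in diffs S T.
  by move=> sS tT; apply/allpairsP; exists (s, t); rewrite /= !mem_enum.
have [|v vD vmin] := @ahead_min (diffs S T) _ Dp.
  by apply: contraTneq (inD _ _ s0S t0T) => ->.
have v0 := dot_gt0 (pointed_neq0 Dp vD).
case/allpairsP: vD v0 vmin => -[A B] [/=]; rewrite !mem_enum => AS BT -> v0 vmin.
have aheadP s t : s \in S -> t \in T -> ahead (vec A - vec B) (vec s - vec t).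
  by move=> sS tT; apply: vmin (inD s t sS tT).
exists A, B; split=> // [s sS|t tT|C CAB].
- by rewrite ffunE; apply: aheadP.
- rewrite ffunE; apply: ahead_sub => //.
  by rewrite opprB addrA subrK; apply: aheadP.
split; apply/negP.
  move=> /aheadP /(_ BT) /(ahead_half v0)/eqP[].
  by rewrite addrACA CAB -addrA; congr (_ + _); rewrite addrA subrr add0r.
move=> /(aheadP A C AS) /(ahead_half v0)/eqP[].
by rewrite addrACA -opprD CAB opprD addrA addrK.
Qed.

(** A relation with positive total weight would equate a weighted mean of true points with one of
    false points, a common point of the two hulls. *)
Lemma thresholdP (R : realType) g : threshold R g ->
  forall (s1 s2 s3 t1 t2 t3 : grid m n),
  g s1 -> g s2 -> g s3 -> ~~ g t1 -> ~~ g t2 -> ~~ g t3 ->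
  forall a b c : int, 0 <= a -> 0 <= b -> 0 <= c ->
  a * (vec s1 - vec t1).1 + b * (vec s2 - vec t2).1
    + c * (vec s3 - vec t3).1 = 0 ->
  a * (vec s1 - vec t1).2 + b * (vec s2 - vec t2).2
    + c * (vec s3 - vec t3).2 = 0 ->
  a + b + c <= 0.
Proof.
move=> gt s1 s2 s3 t1 t2 t3 gs1 gs2 gs3 gt1 gt2 gt3 a b c a0 b0 c0 e1 e2.
rewrite leNgt; apply/negP => abc.
have in_hull nu x1 x2 x3 : g x1 = nu -> g x2 = nu -> g x3 = nu ->
    convex_hull (@grid_point R m n @` level_set nu g)
     ((a%:~R * (x1.1%:R) + b%:~R * (x2.1%:R) + c%:~R * (x3.1%:R))
        / (a%:~R + b%:~R + c%:~R),
      (a%:~R * (x1.2%:R) + b%:~R * (x2.2%:R) + c%:~R * (x3.2%:R))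
        / (a%:~R + b%:~R + c%:~R)).
  move=> g1 g2 g3 C [Cc subC].
  apply: (convex_set3 (p := grid_point R x1) (q := grid_point R x2)
      (r := grid_point R x3) Cc); rewrite ?ler0z //.
  - by apply: subC; exists x1.
  - by apply: subC; exists x2.
  - by apply: subC; exists x3.
  - by rewrite -!intrD ltr0z.
have := in_hull true s1 s2 s3 gs1 gs2 gs3.
have := in_hull false t1 t2 t3 (negbTE gt1) (negbTE gt2) (negbTE gt3).
set p := (X in convex_hull _ X); set q := (X in convex_hull _ X -> False).
suff -> : p = q.
  by move=> H1 H2; have : set0 q by rewrite -gt; split.
have toR (x y z x' y' z' : nat) :
    a * (x%:Z - x'%:Z) + b * (y%:Z - y'%:Z) + c * (z%:Z - z'%:Z) = 0 ->
    a%:~R * x'%:R + b%:~R * y'%:R + c%:~R * z'%:R =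
    a%:~R * x%:R + b%:~R * y%:R + c%:~R * z%:R :> R.
  move=> /(congr1 (fun z => z%:~R : R)).
  rewrite !intrD !intrM !intrB -!pmulrn => e; move: e; rewrite /=; lra.
by congr (_ / _, _ / _); apply: toR.
Qed.

(** Both tests in [ahead] extend to affine functions on the real plane, which give disjoint convex
    sets [H1] and [H0] containing the true and the false points. *)
Lemma threshold_halfplane (R : realType) A B : threshold R (halfplane A B).
Proof.
pose d1 : R := A.1%:R - B.1%:R; pose d2 : R := A.2%:R - B.2%:R.
pose cr (z : R^o * R^o) : R := d1 * (z.2 - B.2%:R) - d2 * (z.1 - B.1%:R).
pose dt (z : R^o * R^o) : R := d1 * (z.1 - A.1%:R) + d2 * (z.2 - A.2%:R).
pose H1 := [set z | 0 < cr z \/ (cr z = 0 /\ 0 <= dt z)].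
pose H0 := [set z | cr z < 0 \/ (cr z = 0 /\ dt z < 0)].
have crE x : cr (grid_point R x) = (cross (vec A - vec B) (vec x - vec B))%:~R.
  by rewrite /cross /= !(intrB, intrM).
have dtE x : dt (grid_point R x) =
   (dot (vec A - vec B) (vec x - vec B) - dot (vec A - vec B) (vec A - vec B))%:~R.
  rewrite /dot /= !(intrB, intrM, intrD) /dt /d1 /d2 /=; ring.
have crc p q (t : R) : cr (t * p.1 + (1 - t) * q.1, t * p.2 + (1 - t) * q.2) =
    t * cr p + (1 - t) * cr q by rewrite /cr /=; ring.
have dtc p q (t : R) : dt (t * p.1 + (1 - t) * q.1, t * p.2 + (1 - t) * q.2) =
    t * dt p + (1 - t) * dt q by rewrite /dt /=; ring.
have H1c : convex_set H1.
  apply/convex_setP => p q t Hp Hq t0 t1; rewrite /H1 /= crc dtc.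
  have t1' : 0 <= 1 - t by rewrite subr_ge0.
  case: Hp => [p0|[-> p0]]; case: Hq => [q0|[-> q0]].
  - left; have [->|tn0] := eqVneq t 0; first by rewrite mul0r add0r subr0 mul1r.
    have : 0 < t * cr p by rewrite mulr_gt0 // lt0r tn0.
    have : 0 <= (1 - t) * cr q by rewrite mulr_ge0 // ltW.
    lra.
  - have [->|tn0] := eqVneq t 0.
      by right; rewrite !mul0r !add0r subr0 mulr0 mul1r.
    by left; rewrite mulr0 addr0 mulr_gt0 // lt0r tn0.
  - have [e|tn1] := eqVneq (1 - t) 0.
      by right; rewrite e !mul0r mulr0 !addr0 mulr_ge0.
    by left; rewrite mulr0 add0r mulr_gt0 // lt0r tn1.
  - by right; rewrite !mulr0 addr0; split=> //; rewrite addr_ge0 ?mulr_ge0.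
have H0c : convex_set H0.
  apply/convex_setP => p q t Hp Hq t0 t1; rewrite /H0 /= crc dtc.
  have t1' : 0 <= 1 - t by rewrite subr_ge0.
  case: Hp => [p0|[-> p0]]; case: Hq => [q0|[-> q0]].
  - left; have [->|tn0] := eqVneq t 0; first by rewrite mul0r add0r subr0 mul1r.
    have : t * cr p < 0 by rewrite pmulr_rlt0 // lt0r tn0.
    have : (1 - t) * cr q <= 0 by rewrite mulr_ge0_le0 // ltW.
    lra.
  - have [->|tn0] := eqVneq t 0.
      by right; rewrite !mul0r !add0r subr0 mulr0 mul1r.
    by left; rewrite mulr0 addr0 pmulr_rlt0 // lt0r tn0.
  - have [e|tn1] := eqVneq (1 - t) 0.
      have t_1 : t = 1 by lra.
      by right; rewrite e t_1 !mul0r mulr0 !addr0 mul1r.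
    by left; rewrite mulr0 add0r pmulr_rlt0 // lt0r tn1.
  - right; rewrite !mulr0 addr0; split=> //.
    have [->|tn0] := eqVneq t 0; first by rewrite mul0r add0r subr0 mul1r.
    have : t * dt p < 0 by rewrite pmulr_rlt0 // lt0r tn0.
    have : (1 - t) * dt q <= 0 by rewrite mulr_ge0_le0 // ltW.
    lra.
rewrite /threshold -subset0 => z [].
move=> /(smallest_sub H0c) z0 /(smallest_sub H1c) z1.
have {}z0 : H0 z.
  apply: z0 => _ [x /= /negbT xf <-]; move: xf.
  rewrite /H0 /= ffunE /ahead crE dtE -subr_ge0 ltrz0.
  rewrite negb_or negb_and -leNgt -ltNge.
  by case: (ltrgtP (cross _ _) 0) => //= [_ _|-> d0]; [left|right; rewrite ltrz0].
have {}z1 : H1 z.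
  apply: z1 => _ [x /= xf <-]; move: xf.
  rewrite /level_set /H1 /= ffunE /ahead crE dtE -subr_ge0 ltr0z ler0z.
  by case/orP => [?|/andP[/eqP-> ?]]; [left|right].
case: z0 => [z0|[z0 z0']]; case: z1 => [z1|[z1 z1']]; lra.
Qed.
End GridFunctions.

(** * Replacing threshold factors by half-planes *)

Section Conjunctions.
Variables (R : realType) (m n : nat).
Implicit Types (A B x : grid m n) (f : {ffun grid m n -> bool}).

Definition is_conj k (g : 'I_k -> {ffun grid m n -> bool}) f : Prop :=
  (forall i, threshold R (g i)) /\ forall x, f x = [forall i, g i x].

Lemma k_thresholdP k f :
  k_threshold R k f <-> exists2 j, (j <= k)%N & exists g : 'I_j -> _, is_conj g f.
Proof.
split=> [[j [jk [g [gt gf]]]]|[j jk [g [gt gf]]]]; exists j => //.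
  exists g; split=> // x; apply/idP/forallP => [fx i|gx].
    by have : level_set true f x by []; rewrite gf => /(_ i I).
  by have : level_set true f x by rewrite gf => i _; exact: gx.
split=> //; exists g; split=> //; apply/seteqP; split=> x; rewrite /level_set /=.
  by rewrite gf => /forallP gx i _; exact: gx.
by move=> gx; rewrite gf; apply/forallP => i; exact: gx.
Qed.

Lemma is_conj_drop k (g : 'I_k.+1 -> {ffun grid m n -> bool}) f i :
  is_conj g f -> (forall x, (forall j, j != i -> g j x) -> g i x) ->
  is_conj (fun j => g (lift i j)) f.
Proof.
move=> [gt gf] gi; split=> // x; rewrite gf.
apply/forallP/forallP => gx j //.
have gx' j' : j' != i -> g j' x.
  by rewrite eq_sym => /unlift_some[j'' -> _]; exact: gx.
by have [->|/gx'//] := eqVneq j i; exact: gi.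
Qed.

Definition same_parity A B : bool :=
  (odd A.1 == odd B.1) && (odd A.2 == odd B.2).

Lemma same_parity_midpoint A B :
  same_parity A B -> exists C : grid m n, vec C + vec C = vec A + vec B.
Proof.
have mid k (a b : 'I_k) : odd a == odd b ->
    exists c : 'I_k, c%:Z + c%:Z = a%:Z + b%:Z :> int.
  move=> ab; have lt : ((a + b)./2 < k)%N by have := ltn_ord a; have := ltn_ord b; lia.
  exists (Ordinal lt) => /=; move/eqP: ab; lia.
by move=> /andP[/mid[c1 e1] /mid[c2 e2]]; exists (c1, c2); rewrite /vec /=; congr pair.
Qed.

Lemma threshold_midpoint (g : {ffun grid m n -> bool}) A B C :
  threshold R g -> g A -> g B -> vec C + vec C = vec A + vec B -> g C.
Proof.
move=> gt gA gB CAB; apply/negPn/negP => gC.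
have := thresholdP gt gA gB gB gC gC gC ler01 ler01 (lexx 0).
have e1 : C.1%:Z + C.1%:Z = A.1%:Z + B.1%:Z :> int := congr1 fst CAB.
have e2 : C.2%:Z + C.2%:Z = A.2%:Z + B.2%:Z :> int := congr1 snd CAB.
rewrite /= => H; have : (1 + 1 + 0 : int) <= 0 by apply: H; lra.
by [].
Qed.

(** [T] collects the points that only [g i] excludes; it is nonempty, since otherwise [g i] could be
    dropped. As [g i] separates [T] from the support of [f], a tangent between the two exists and
    its half-plane can take over from [g i]. *)
Lemma is_conj_replace k (g : 'I_k.+1 -> {ffun grid m n -> bool}) f i x0 :
  is_conj g f -> (forall g' : 'I_k -> _, ~ is_conj g' f) -> f x0 ->
  exists A B, [/\ f A, ~~ same_parity A B &
    is_conj (fun j => if j == i then halfplane A B else g j) f].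
Proof.
move=> gf nf fx0; have [gt fE] := gf.
pose T := [set x | ~~ f x && [forall (j | j != i), g j x]]%SET.
have [t0 t0T] : exists t0, t0 \in T.
  apply/set0Pn/eqP => T0; apply: (nf (fun j => g (lift i j))).
  apply: is_conj_drop => // x gx; apply/negPn/negP => gix.
  have : x \in T.
    rewrite inE; apply/andP; split; last by apply/forall_inP.
    by rewrite fE; apply/negP => /forallP/(_ i); rewrite (negbTE gix).
  by rewrite T0 inE.
have fg x j : f x -> g j x by rewrite fE => /forallP.
have TgN t : t \in T -> ~~ g i t.
  rewrite inE fE => /andP[/forallPn[j gj] /forall_inP gt'].
  by have [<-//|/gt'] := eqVneq j i; rewrite (negbTE gj).
pose S := [set x | f x]%SET.
have [|||A [B [AS BT SH TH AB]]] := @halfplane_sep m n (mem S) (mem T) x0 t0.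
- by rewrite !inE.
- by [].
- move=> u v w /allpairsP[[s1 t1] [/=]]; rewrite !mem_enum => s1S t1T ->.
  move=> /allpairsP[[s2 t2] [/=]]; rewrite !mem_enum => s2S t2T ->.
  move=> /allpairsP[[s3 t3] [/=]]; rewrite !mem_enum => s3S t3T ->.
  move: s1S s2S s3S; rewrite !inE => /fg s1S /fg s2S /fg s3S.
  exact: (thresholdP (gt i)) (s1S i) (s2S i) (s3S i) (TgN _ t1T) (TgN _ t2T) (TgN _ t3T).
have fA : f A by move: AS; rewrite inE.
exists A, B; split=> //.
(* The other factors hold at [A] and [B], hence at their midpoint, which would lie in [S] or in
   [T]. *)
- apply/negP => /same_parity_midpoint[C CAB].
  have [CS CT] := AB C CAB.
  case/negP: CT; rewrite !inE; move: CS; rewrite !inE => -> /=.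
  apply/forall_inP => j ji; apply: threshold_midpoint (gt j) (fg _ _ fA) _ CAB.
  by move: BT; rewrite inE => /andP[_ /forall_inP]; apply.
split=> [j|x].
  by case: ifP => // _; apply: threshold_halfplane.
apply/idP/forallP => [fx j|gx].
  by case: ifP => _; [apply: SH; rewrite inE|exact: fg].
apply/negPn/negP => fx; have /TH : x \in T.
  rewrite inE fx; apply/forall_inP => j ji.
  by have := gx j; rewrite (negbTE ji).
by have := gx i; rewrite eqxx => ->.
Qed.

(** Each replacement keeps [f] and the other factors, so [main] inducts on the number [l] of leading
    factors already replaced. *)
Lemma is_conj_halfplanes k (g : 'I_k.+1 -> {ffun grid m n -> bool}) f x0 :
  is_conj g f -> (forall g' : 'I_k -> _, ~ is_conj g' f) -> f x0 ->
  exists p : 'I_k.+1 -> grid m n * grid m n,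
    (forall i, f (p i).1 /\ ~~ same_parity (p i).1 (p i).2) /\
    is_conj (fun i => halfplane (p i).1 (p i).2) f.
Proof.
move=> gf nf fx0.
have main l : (l <= k.+1)%N ->
    exists2 g' : 'I_k.+1 -> _, is_conj g' f &
    forall i : 'I_k.+1, (i < l)%N -> exists AB : grid m n * grid m n,
      [/\ f AB.1, ~~ same_parity AB.1 AB.2 & g' i = halfplane AB.1 AB.2].
  elim: l => [_|l IH lk]; first by exists g.
  have [g1 g1f Hg1] := IH (ltnW lk).
  have [A [B [fA AB g2f]]] := is_conj_replace (Ordinal lk) g1f nf fx0.
  exists (fun j => if j == Ordinal lk then halfplane A B else g1 j) => // i il.
  case: eqVneq => [_|ne]; first by exists (A, B).
  by apply: Hg1; rewrite ltn_neqAle -ltnS il andbT.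
have [g' g'f Hg'] := main _ (leqnn _).
have [p pP] := choice (fun i => Hg' i (ltn_ord i)).
exists p; split=> [i|]; first by have [] := pP i.
suff -> : (fun i => halfplane (p i).1 (p i).2) = g' by [].
by apply/funext => i; have [_ _ ->] := pP i.
Qed.

(** The properties kept for counting. The last says that every first endpoint satisfies the whole
    conjunction; injectivity makes the reorderings of a tuple distinct. *)
Definition valid k (p : {ffun 'I_k -> grid m n * grid m n}) : bool :=
  [&& injectiveb p, [forall i, ~~ same_parity (p i).1 (p i).2] &
      [forall i, [forall j, halfplane (p i).1 (p i).2 (p j).1]]].

Definition conj_halfplanes k (p : {ffun 'I_k -> grid m n * grid m n}) :
    {ffun grid m n -> bool} :=
  [ffun x => [forall i, halfplane (p i).1 (p i).2 x]].

(** The case [k = 0] is separate because [k.-1] is then 0 again; the empty tuple serves there. *)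
Lemma conj_valid k (g : 'I_k -> {ffun grid m n -> bool}) f x0 :
  is_conj g f -> ~ k_threshold R k.-1 f \/ k = 0%N -> f x0 ->
  exists2 p : {ffun 'I_k -> grid m n * grid m n}, valid p & conj_halfplanes p = f.
Proof.
case: k g => [|k] g gf nf fx0.
  exists [ffun i => (x0, x0)].
    by apply/and3P; split; [apply/injectiveP|apply/forallP|apply/forallP] => -[].
  apply/ffunP => x; rewrite ffunE; have [_ ->] := gf.
  by apply/forallP/forallP => _ [].
have {}nf : forall g' : 'I_k -> _, ~ is_conj g' f.
  case: nf => // nf g' g'f; apply: nf; apply/k_thresholdP.
  by exists k => //; exists g'.
have [p [pA [pt pf]]] := is_conj_halfplanes gf nf fx0.
exists (finfun p); last first.
  by apply/ffunP => x; rewrite ffunE pf; apply: eq_forallb => i; rewrite [finfun p i]ffunE.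
apply/and3P; split.
(* A repeated pair would make one factor redundant, against minimality. *)
- apply/injectiveP => i j; rewrite !ffunE => pij; apply/eqP/negPn/negP => ij.
  apply: (nf (fun l => halfplane (p (lift i l)).1 (p (lift i l)).2)).
  apply: (@is_conj_drop _ (fun l => halfplane (p l).1 (p l).2)) => //.
  by move=> x /(_ j); rewrite eq_sym pij; apply.
- by apply/forallP => i; rewrite ffunE; case: (pA i).
- apply/forallP => i; apply/forallP => j.
  rewrite [finfun p i]ffunE [finfun p j]ffunE.
  by have [+ _] := pA j; rewrite pf => /forallP.
Qed.

End Conjunctions.

Local Close Scope ring_scope.
Local Close Scope classical_set_scope.

(** * Counting *)

Definition ord_convex m (D : {set 'I_m}) : Prop :=
  forall x y z : 'I_m, x < y < z -> x \in D -> z \in D -> y \in D.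

(** The successor of an element of the wrong parity has the right one; in an interval only the
    maximum lacks a successor, whence the [+ 1]. *)
Lemma card_interval_parity m (D : {set 'I_m}) (a : bool) :
  ord_convex D -> #|D| <= 2 * #|[set x in D | odd x == a]|%SET + 1.
Proof.
case: m D => [|m] D Dc.
  by rewrite (leq_trans (max_card _)) // card_ord.
have [->|[x0 x0D]] := set_0Vmem D; first by rewrite cards0.
pose M := [arg max_(x > x0 in D) (x : nat)].
have [MD Mmax] : M \in D /\ forall x, x \in D -> x <= M.
  by rewrite /M; case: arg_maxnP.
set E := [set x in D | odd x == a]%SET.
have DE : D \subset (M |: E) :|: (D :\: (M |: E)).
  by apply/fintype.subsetP => x xD; rewrite !inE xD; case: (x == M); case: (odd x == a).
suff le : #|D :\: (M |: E)| <= #|E|.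
  rewrite (leq_trans (subset_leq_card DE)) //.
  rewrite (leq_trans (leq_card_setU _ _)) //.
  rewrite cardsU1; case: (M \notin E); lia.
have lt (x : 'I_m.+1) : x \in D :\: (M |: E) -> x.+1 <= M.
  rewrite !inE negb_or => /andP[/andP[xM _] xD].
  by rewrite ltn_neqAle Mmax // andbT.
have [f fE] : exists f : 'I_m.+1 -> 'I_m.+1, forall x : 'I_m.+1, x < M -> f x = x.+1 :> nat.
  by exists (fun x => inord x.+1) => x xM; rewrite inordK // (leq_ltn_trans xM).
rewrite -(@card_in_imset _ _ f); last first.
  move=> x y /lt xM /lt yM fxy; apply: val_inj.
  by have := congr1 val fxy; rewrite /= !fE // => -[].
apply/subset_leq_card/fintype.subsetP => _ /imsetP[x xD ->].
have xM := lt _ xD; rewrite inE fE //=.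
move: xD; rewrite !inE negb_or negb_and => /andP[/andP[_ xa] xD].
rewrite xD /= in xa; apply/andP; split; last by move: xa; case: (odd x); case: a {E DE lt}.
move: xM; rewrite leq_eqVlt => /predU1P[e|xM].
  by rewrite (_ : f x = M) //; apply: val_inj; rewrite /= fE -e.
by apply: (Dc x _ M) => //; rewrite fE ?xM ?ltnSn // ltnW.
Qed.

(** * Parity classes and lines in the grid *)

Section Counting.
Variables m n : nat.
Local Notation G := (grid m n).

Lemma card_cols (D : {set G}) :
  #|D| = \sum_(x < m) #|[set y | (x, y) \in D]|%SET.
Proof.
transitivity (\sum_x \sum_y ((x, y) \in D : nat)).
  by rewrite pair_bigA -sum1_card big_mkcond /=; apply: eq_bigr => -[x y] _ /=; case: ifP.
apply: eq_bigr => x _; rewrite -sum1_card [RHS]big_mkcond /=.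
by apply: eq_bigr => y _; rewrite inE; case: ifP.
Qed.

Lemma card_rows (D : {set G}) :
  #|D| = \sum_(y < n) #|[set x | (x, y) \in D]|%SET.
Proof.
transitivity (\sum_x \sum_y ((x, y) \in D : nat)).
  by rewrite pair_bigA -sum1_card big_mkcond /=; apply: eq_bigr => -[x y] _ /=; case: ifP.
rewrite exchange_big; apply: eq_bigr => y _; rewrite -sum1_card [RHS]big_mkcond /=.
by apply: eq_bigr => x _; rewrite inE; case: ifP.
Qed.

(** Fixing the first parity keeps at least half of each row, up to an error for each of the [n]
    rows; fixing the second does the same with the [m] columns. So the class of [A] takes at least
    about a quarter of [D]. *)
Lemma card_parity_class (D : {set G}) (A : G) :
  (forall y, ord_convex [set x | (x, y) \in D]%SET) ->
  (forall x, ord_convex [set y | (x, y) \in D]%SET) ->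
  4 * #|D :\: [set B | same_parity A B]| <= 3 * #|D| + 2 * (m + n).
Proof.
move=> rows cols.
set D1 := [set z in D | odd z.1 == odd A.1]%SET.
set D2 := [set z in D1 | odd z.2 == odd A.2]%SET.
have le1 : #|D| <= 2 * #|D1| + n.
  rewrite card_rows [#|D1|]card_rows big_distrr /= -[X in _ + X]card_ord -sum1_card.
  rewrite -big_split leq_sum //= => y _.
  rewrite (leq_trans (card_interval_parity (odd A.1) (rows y))) //.
  by rewrite leq_add2r leq_mul2l /= (eq_leq (eq_card _)) // => x; rewrite !inE.
have le2 : #|D1| <= 2 * #|D2| + m.
  rewrite card_cols [#|D2|]card_cols big_distrr /= -[X in _ + X]card_ord -sum1_card.
  rewrite -big_split leq_sum //= => x _.
  (* The first parity is constant on a column, so the column of [D1] is that of [D] or empty. *)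
  have c1 : ord_convex [set y | (x, y) \in D1]%SET.
    move=> y1 y2 y3 lt; rewrite !inE => /andP[h1 ->] /andP[h3 _]; rewrite andbT.
    by have := cols x y1 y2 y3 lt; rewrite !inE; apply.
  rewrite (leq_trans (card_interval_parity (odd A.2) c1)) //.
  by rewrite leq_add2r leq_mul2l /= (eq_leq (eq_card _)) // => y; rewrite !inE.
have : #|D| = #|D2| + #|D :\: [set B | same_parity A B]%SET|.
  rewrite -(cardsID [set B | same_parity A B]%SET D); congr (_ + _).
  by apply: eq_card => z; rewrite !inE /same_parity ![odd (_ A) == _]eq_sym andbA.
by lia.
Qed.

Definition line (P Q : G) : {set G} :=
  [set B | cross (vec P - vec B)%R (vec Q - vec B)%R == 0%R].

(** One coordinate is injective on the line: the first if the line is horizontal, the second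
    otherwise. *)
Lemma card_line (P Q : G) : P != Q -> #|line P Q| <= m + n.
Proof.
move=> PQ.
have inj (T : finType) (h : G -> T) : {in line P Q &, injective h} -> #|line P Q| <= #|T|.
  by move=> h_inj; rewrite -(card_in_imset h_inj) max_card.
have [e2|n2] := eqVneq P.2 Q.2.
  have n1 : (P.1 : nat) != Q.1.
    by apply: contraNneq PQ => /val_inj e1; rewrite -pair_eqE /= /pair_eq /= e1 e2 !eqxx.
  rewrite (leq_trans (inj _ fst _)) ?card_ord ?leq_addr // => -[x y] [x' y'].
  rewrite !inE /cross /= => e e' exx; subst x'; congr pair; apply: val_inj => /=.
  have : ((y%:Z - y'%:Z) * (P.1%:Z - Q.1%:Z) = 0)%R by move/eqP: e; move/eqP: e'; lra.
  by move/eqP; rewrite mulf_eq0 !subr_eq0 => /orP[/eqP[]//|/eqP[PQe]]; rewrite PQe eqxx in n1.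
have {}n2 : (P.2 : nat) != Q.2 by apply: contraNneq n2 => /val_inj ->.
rewrite (leq_trans (inj _ snd _)) ?card_ord ?leq_addl // => -[x y] [x' y'].
rewrite !inE /cross /= => e e' eyy; subst y'; congr pair; apply: val_inj => /=.
have : ((x%:Z - x'%:Z) * (P.2%:Z - Q.2%:Z) = 0)%R by move/eqP: e; move/eqP: e'; lra.
by move/eqP; rewrite mulf_eq0 !subr_eq0 => /orP[/eqP[]//|/eqP[PQe]]; rewrite PQe eqxx in n2.
Qed.

End Counting.

(** * Second endpoints for fixed first endpoints *)

Section ValidTuples.
Variables (m n k : nat).
Local Notation G := (grid m n).
Implicit Types A : {ffun 'I_k -> G}.

(** The strict inequalities make the cones of distinct indices disjoint; what [weak_cone] has in
    addition lies on lines. *)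
Definition cone A i : {set G} :=
  [set B | [forall (j | j != i), (0 < cross (vec (A i) - vec B) (vec (A j) - vec B))%R]].

Definition weak_cone A i : {set G} :=
  [set B | ~~ same_parity (A i) B && [forall j, halfplane (A i) B (A j)]].

Lemma cone_disjoint A i j : i != j -> [disjoint cone A i & cone A j].
Proof.
move=> ij; rewrite -setI_eq0; apply/eqP/setP => B; rewrite !inE.
apply/negP => /andP[/forall_inP/(_ j) + /forall_inP/(_ i ij)].
rewrite eq_sym => /(_ ij); rewrite /cross; lra.
Qed.

Lemma sum_card_cone A : \sum_i #|cone A i| <= m * n.
Proof.
have <- : #|{: G}| = m * n by rewrite card_prod !card_ord.
under eq_bigr do rewrite -sum1_card.
rewrite -partition_disjoint_bigcup ?sum1_card ?max_card //.
exact: cone_disjoint.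
Qed.

(** With one coordinate of [B] fixed, the cross products that define a cone are affine in the other,
    so rows and columns of cones are intervals. *)
Lemma affine_gt0_between (a b x y z : int) :
  (x < y < z -> 0 < a * x + b -> 0 < a * z + b -> 0 < a * y + b)%R.
Proof.
move=> /andP[xy yz] px pz; have [a0|a0] := lerP 0%R a.
  by rewrite (lt_le_trans px) // lerD2r ler_wpM2l // ltW.
by rewrite (lt_le_trans pz) // lerD2r ler_wnM2l // ltW.
Qed.

Lemma cone_rows A i y : ord_convex [set x | (x, y) \in cone A i]%SET.
Proof.
move=> x1 x2 x3 /andP[x12 x23]; rewrite !inE => /forall_inP c1 /forall_inP c3.
apply/forall_inP => j ji; move: (c1 j ji) (c3 j ji).
have cE z : (cross (vec (A i) - vec (z, y)) (vec (A j) - vec (z, y)) =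
    ((vec (A i)).2 - (vec (A j)).2) * z%:Z +
    ((vec (A i)).1 * (vec (A j)).2 - (vec (A i)).2 * (vec (A j)).1 -
      ((vec (A i)).1 - (vec (A j)).1) * y%:Z))%R.
  by rewrite /cross /=; ring.
by rewrite !cE; apply: affine_gt0_between; rewrite !ltz_nat x12.
Qed.

Lemma cone_cols A i x : ord_convex [set y | (x, y) \in cone A i]%SET.
Proof.
move=> y1 y2 y3 /andP[y12 y23]; rewrite !inE => /forall_inP c1 /forall_inP c3.
apply/forall_inP => j ji; move: (c1 j ji) (c3 j ji).
have cE z : (cross (vec (A i) - vec (x, z)) (vec (A j) - vec (x, z)) =
    ((vec (A j)).1 - (vec (A i)).1) * z%:Z +
    ((vec (A i)).1 * (vec (A j)).2 - (vec (A i)).2 * (vec (A j)).1 -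
      ((vec (A j)).2 - (vec (A i)).2) * x%:Z))%R.
  by rewrite /cross /=; ring.
by rewrite !cE; apply: affine_gt0_between; rewrite !ltz_nat y12.
Qed.

(** Points of [weak_cone] outside [cone] lie on lines through [A i] and another [A j]. At most [k]
    lines of at most [m + n] points account for [4 * k], the parity count for [2]. *)
Lemma card_weak_cone A i : injective A ->
  4 * #|weak_cone A i| <= 3 * #|cone A i| + (4 * k + 2) * (m + n).
Proof.
move=> Ai.
have sub : weak_cone A i \subset (cone A i :\: [set B | same_parity (A i) B])
    :|: \bigcup_(j | j != i) line (A i) (A j).
  apply/fintype.subsetP => B; rewrite !inE => /andP[AB /forallP h].
  rewrite AB /= orbC -implyNb; apply/implyP => noline; apply/forall_inP => j ji.
  move: (h j); rewrite ffunE /ahead => /orP[//|/andP[cr0 _]].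
  by case/negP: noline; apply/bigcupP; exists j; rewrite ?inE.
have le_lines : #|\bigcup_(j | j != i) line (A i) (A j)| <= k * (m + n).
  have -> : k * (m + n) = \sum_(j < k) (m + n) by rewrite sum_nat_const card_ord.
  rewrite [leqRHS](bigID (fun j => j != i)) /= (leq_trans _ (leq_addr _ _)) //.
  apply: (@big_ind2 _ _ (fun (S : {set G}) c => #|S| <= c)); first by rewrite cards0.
    by move=> S a T b Sa Tb; rewrite (leq_trans (leq_card_setU _ _)) // leq_add.
  by move=> j ji; apply: card_line; rewrite (inj_eq Ai) eq_sym.
have := card_parity_class (A i) (@cone_rows A i) (@cone_cols A i).
have := leq_trans (subset_leq_card sub) (leq_card_setU _ _).
move: le_lines; move: #|_| #|_ :\: _| #|cone _ _| #|_| => *; nia.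
Qed.

(** AM-GM in its division-free form, applied to [4 * #|weak_cone A i|]; disjointness of the cones
    bounds the sum. *)
Lemma prod_card_weak_cone A : injective A ->
  (4 * k) ^ k * \prod_i #|weak_cone A i| <=
  (3 * (m * n) + k * (4 * k + 2) * (m + n)) ^ k.
Proof.
move=> Ai.
have -> : (4 * k) ^ k * \prod_i #|weak_cone A i| = \prod_(i < k) (4 * #|weak_cone A i| * k).
  rewrite -[X in _ ^ X]card_ord -prod_nat_const -big_split /=.
  by apply: eq_bigr => i _; rewrite mulnAC.
have := @leif_AGM_scaled int 'I_k xpredT (fun i => (4 * #|weak_cone A i|)%:R%R).
rewrite card_ord => /(_ (fun i _ => mulrn_wge0 _ (ler0n _ _)))[+ _].
under eq_bigr do rewrite -mulrnA.
rewrite -natr_sum -natr_prod -natrX ler_nat => /leq_trans; apply.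
have expW (a b e : nat) : a <= b -> a ^ e <= b ^ e.
  by case: e => // e ab; rewrite leq_exp2r.
apply: expW.
have /leq_trans -> // : \sum_(i < k) 4 * #|weak_cone A i| <=
    \sum_(i < k) (3 * #|cone A i| + (4 * k + 2) * (m + n)).
  by apply: leq_sum => i _; apply: card_weak_cone.
rewrite big_split /= -big_distrr sum_nat_const card_ord /= mulnA leq_add2r.
by rewrite leq_mul2l sum_card_cone.
Qed.

Lemma card_fibre_valid A : injective A ->
  #|[set B : {ffun 'I_k -> G} | valid [ffun i => (A i, B i)]]| <= \prod_i #|weak_cone A i|.
Proof.
move=> Ai.
have -> : \prod_i #|weak_cone A i| = #|family (fun i => mem (weak_cone A i))|.
  by rewrite card_family foldrE big_image.
apply/subset_leq_card/fintype.subsetP => B; rewrite inE => /and3P[_ /forallP h1 /forallP h2].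
apply/familyP => i; rewrite !inE; move: (h1 i) (h2 i); rewrite ffunE /= => -> /forallP h.
by apply/forallP => j; have := h j; rewrite [finfun _ j]ffunE.
Qed.

End ValidTuples.

(** Bounds the number of non-injective [k]-tuples from [N] points. *)
Lemma expn_ffact_le N k : N ^ k <= N ^_ k + k ^ 2 * N ^ k.-1.
Proof.
elim: k => [|k IH]; first by rewrite ffactn0.
rewrite /= ffactnSr expnSr.
have : N ^_ k * N <= N ^_ k * (N - k) + k * N ^ k.
  have le : N ^_ k <= N ^ k.
    by elim: (k) => // j IHj; rewrite ffactnSr expnSr leq_mul // leq_subr.
  rewrite [k * _]mulnC (leq_trans _ (leq_add (leqnn _) (leq_mul le (leqnn k)))) //.
  by rewrite -mulnDr leq_mul2l; lia.
have : k ^ 2 * N ^ k.-1 * N <= k ^ 2 * N ^ k.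
  by case: k {IH} => // k; rewrite [N ^ k.+1]expnSr mulnA.
move: (N ^ k) (N ^ k.-1) (N ^_ k) IH => a b c; nia.
Qed.

(** * Counting valid tuples and their conjunctions *)

Section CountValid.
Variables (m n k : nat).
Local Notation G := (grid m n).

(** Tuples are grouped by their first endpoints [A]. Injective [A] give the main term; the others
    number at most [k ^ 2 * (m * n) ^ k.-1], each with at most [(m * n) ^ k] choices of second
    endpoints. *)
Lemma card_valid :
  (4 * k) ^ k * #|[set p : {ffun 'I_k -> G * G} | valid p]| <=
  (m * n) ^ k * (3 * (m * n) + k * (4 * k + 2) * (m + n)) ^ k +
  (4 * k) ^ k * (k ^ 2 * (m * n) ^ (k.-1 + k)).
Proof.
set E := ((3 * (m * n) + k * (4 * k + 2) * (m + n)) ^ k).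
have cG : #|{: G}| = m * n by rewrite card_prod !card_ord.
rewrite -sum1_card (partition_big (fun p : {ffun 'I_k -> G * G} => [ffun i => (p i).1]) xpredT) //=.
rewrite big_distrr /= (bigID (fun A : {ffun 'I_k -> G} => injectiveb A)) /=.
have fibre (A : {ffun 'I_k -> G}) :
    \sum_(p | (p \in [set p | valid p]%SET) && ([ffun i => (p i).1] == A)) 1 <=
    #|[set B : {ffun 'I_k -> G} | valid [ffun i => (A i, B i)]]%SET|.
  rewrite sum1_card.
  pose snd_of (p : {ffun 'I_k -> G * G}) : {ffun 'I_k -> G} := [ffun i => (p i).2].
  have pE (p : {ffun 'I_k -> G * G}) : [ffun i => (p i).1] = A -> p = [ffun i => (A i, snd_of p i)].
    by move=> <-; apply/ffunP => i; rewrite !ffunE -surjective_pairing.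
  rewrite -(@card_in_imset _ _ snd_of); last first.
    move=> p q /andP[_ /eqP/pE pA] /andP[_ /eqP/pE qA] pq.
    by rewrite pA qA pq.
  apply/subset_leq_card/fintype.subsetP => _ /imsetP[p /andP[+ /eqP/pE pA] ->].
  by rewrite !inE {1}pA.
apply: leq_add.
  apply: (@leq_trans (\sum_(A : {ffun 'I_k -> G} | injectiveb A) E)).
    apply: leq_sum => A /injectiveP Ai.
    rewrite (leq_trans _ (prod_card_weak_cone Ai)) // leq_mul2l.
    by rewrite (leq_trans (fibre A)) ?orbT // card_fibre_valid.
  rewrite sum_nat_const leq_mul2r (leq_trans (max_card _)) ?orbT //.
  by rewrite card_ffun card_ord cG.
apply: (@leq_trans (\sum_(A : {ffun 'I_k -> G} | ~~ injectiveb A) (4 * k) ^ k * (m * n) ^ k)).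
  apply: leq_sum => A _; rewrite leq_mul2l (leq_trans (fibre A)) ?orbT //.
  by rewrite (leq_trans (max_card _)) // card_ffun card_ord cG.
rewrite sum_nat_const mulnCA leq_mul2l expnD mulnA leq_mul2r; apply/orP; right; apply/orP; right.
have := cardC (fun A : {ffun 'I_k -> G} => injectiveb A).
rewrite card_ffun card_ord cG.
have := card_inj_ffuns 'I_k G; rewrite cardsE cG card_ord => ->.
have := expn_ffact_le (m * n) k; rewrite -[#|predC _|]/#|(fun A : {ffun 'I_k -> G} => ~~ injectiveb A)|.
lia.
Qed.

(** Permuting indices preserves validity and the conjunction, and acts freely on injective tuples,
    so each conjunction comes from at least k factorial valid tuples. *)
Lemma card_conj_valid :
  k`! * #|[set conj_halfplanes p | p in [set p : {ffun 'I_k -> G * G} | valid p]]| <=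
  #|[set p : {ffun 'I_k -> G * G} | valid p]|.
Proof.
set V := [set p | valid p].
rewrite -[#|V|]sum1_card (partition_big_imset (@conj_halfplanes m n k)) /=.
rewrite mulnC -sum_nat_const leq_sum // => _ /imsetP[p pV ->].
rewrite sum1_card -card_Sn.
pose act (s : 'S_k) : {ffun 'I_k -> G * G} := [ffun i => p (s i)].
have p_inj : injective p by move: pV; rewrite inE => /and3P[/injectiveP].
have act_inj : injective act.
  move=> s t /ffunP st; apply/permP => i; apply: p_inj.
  by have := st i; rewrite !ffunE.
rewrite -(card_imset _ act_inj); apply/subset_leq_card/fintype.subsetP.
move=> _ /imsetP[s _ ->]; move: pV; rewrite inE.
move=> /and3P[_ /forallP h1 /forallP h2]; rewrite unfold_in; apply/andP; split.
  rewrite inE; apply/and3P; split.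
  - by apply/injectiveP => i j; rewrite !ffunE => /p_inj/perm_inj.
  - by apply/forallP => i; rewrite ffunE.
  - apply/forallP => i; apply/forallP => j.
    by rewrite [act s i]ffunE [act s j]ffunE; have /forallP := h2 (s i); apply.
apply/eqP/ffunP => x; rewrite !ffunE; apply/forallP/forallP => h i.
  by have := h ((s^-1)%g i); rewrite [act s _]ffunE permKV.
by rewrite [act s _]ffunE.
Qed.

End CountValid.

(** * Bounds for the number of k-threshold functions *)

Section NumThreshold.
Variables (R : realType) (m n : nat).
Local Notation G := (grid m n).

(** The summand [1] is the constantly false function, whose empty support admits no tangent. *)
Lemma num_k_threshold_succ k :
  num_k_threshold R k.+1 m n <= num_k_threshold R k m n + 1 +
    #|[set conj_halfplanes p | p in [set p : {ffun 'I_k.+1 -> G * G} | valid p]]|.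
Proof.
rewrite /num_k_threshold -[X in _ + X + _](@cards1 {ffun G -> bool} [ffun => false]).
apply: leq_trans (leq_add (leq_card_setU _ _) (leqnn _)).
apply: leq_trans (leq_card_setU _ _).
apply/subset_leq_card/fintype.subsetP => f; rewrite !inE => /asboolP/asboolP fk.
have [/asboolP->//|nf] := pselect (k_threshold R k f).
have [->|f0] := eqVneq f [ffun=> false]; first by rewrite orbT.
apply/orP; right.
have [x0 fx0] : exists x0, f x0.
  apply/existsP; apply: contraR f0; rewrite negb_exists => /forallP f0.
  by apply/eqP/ffunP => x; rewrite ffunE; apply/negbTE.
have [j jk [g gf]] := (k_thresholdP R k.+1 f).1 fk.
have jE : j = k.+1.
  apply/eqP; rewrite eqn_leq jk ltnNge; apply/negP => jk'.
  by apply: nf; apply/k_thresholdP; exists j => //; exists g.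
subst j; have [p pv <-] := conj_valid gf (or_introl nf) fx0.
by apply/imsetP; exists p; rewrite ?inE.
Qed.

(** A crude bound, by which functions with fewer factors are of lower order in the sharp count. *)
Lemma num_k_threshold_le k : 0 < m * n ->
  num_k_threshold R k m n <= k.+1 * 2 * (m * n) ^ (2 * k).
Proof.
move=> N0; elim: k => [|k IH].
  rewrite muln0 expn0 (@leq_trans 1) // -(@cards1 {ffun G -> bool} [ffun => true]).
  apply/subset_leq_card/fintype.subsetP => f; rewrite !inE => /asboolP/asboolP.
  move=> /k_thresholdP[[|//] _ [g [_ gf]]]; apply/eqP/ffunP => x.
  by rewrite ffunE gf; apply/forallP => -[].
rewrite (leq_trans (num_k_threshold_succ k)) //.
have h1 : #|[set conj_halfplanes p | p in [set p : {ffun 'I_k.+1 -> G * G} | valid p]]|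
    <= (m * n) ^ (2 * k.+1).
  rewrite (leq_trans (leq_imset_card _ _)) // (leq_trans (max_card _)) //.
  by rewrite card_ffun !card_prod !card_ord mulnn -expnM.
have h2 : (m * n) ^ (2 * k) <= (m * n) ^ (2 * k.+1) by rewrite leq_pexp2l //; lia.
have h3 : 1 <= (m * n) ^ (2 * k.+1) by rewrite expn_gt0 N0.
have h4 : k.+1 * 2 * (m * n) ^ (2 * k) <= k.+1 * 2 * (m * n) ^ (2 * k.+1).
  by rewrite leq_mul2l h2 orbT.
rewrite [k.+2 * 2]mulSn mulnDl; lia.
Qed.

(** The error coefficient collects [k.+1 * 2] for functions with at most [k] factors, [1] for the
    false function and [k.+1 ^ 2] for repeated first endpoints; its power of [N] is one below the
    leading one. *)
Lemma num_k_threshold_main k (N := m * n)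
    (E := 3 * N + k.+1 * (4 * k.+1 + 2) * (m + n)) : 0 < N ->
  (k.+1)`! * (4 * k.+1) ^ k.+1 * num_k_threshold R k.+1 m n <=
  N ^ k.+1 * E ^ k.+1 +
  (k.+1)`! * (4 * k.+1) ^ k.+1 * ((k.+1 * 2 + 1 + k.+1 ^ 2) * N ^ (k + k.+1)).
Proof.
move=> N0; have := num_k_threshold_succ k; have := num_k_threshold_le k N0.
have := card_conj_valid m n k.+1; have := card_valid m n k.+1.
rewrite -/N -/E [k.+1.-1]/=.
have h2 : N ^ (2 * k) <= N ^ (k + k.+1) by rewrite leq_pexp2l //; lia.
have h3 : 1 <= N ^ (k + k.+1) by rewrite expn_gt0 N0.
have h4 : 1 <= (k.+1)`! by rewrite fact_gt0.
move: h2 h3 h4; set t := num_k_threshold R _ _ _; set t' := num_k_threshold R _ _ _.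
set V := #|_|; set I := #|_|; set F := (k.+1)`!; set P := _ ^ k.+1.
set E' := N ^ _ * _; set X := N ^ (k + _); set Y := N ^ (2 * k); set K := k.+1.
clearbody t t' I V F P E' X Y K.
move=> YX X1 F1 hV hI ht' ht.
apply: (@leq_trans (F * P * (K * 2 * X + X) + P * (F * I))); last first.
  apply: leq_trans (leq_add (leqnn _) (leq_mul (leqnn P) hI)) _.
  apply: leq_trans (leq_add (leqnn _) hV) _.
  have : P * (K ^ 2 * X) <= F * P * (K ^ 2 * X) by rewrite -mulnA leq_pmull.
  have -> : (K * 2 + 1 + K ^ 2) * X = (K * 2 * X + X) + K ^ 2 * X.
    by rewrite !mulnDl mul1n.
  rewrite [F * P * (_ + K ^ 2 * X)]mulnDr addnCA leq_add2l; lia.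
have -> : P * (F * I) = F * P * I by rewrite mulnCA mulnA.
rewrite -mulnDr leq_mul2l; apply/orP; right.
have : K * 2 * Y <= K * 2 * X by rewrite leq_mul2l YX orbT.
lia.
Qed.

End NumThreshold.

Local Open Scope classical_set_scope.
Local Open Scope ring_scope.

(** * Comparison of the constants *)

(** In the negated series the omitted terms pair up to positive sums, since for [x <= 2] each is
    larger in size than the next. *)
Lemma cos_lt_taylor4 (R : realType) (x : R) : 0 < x -> x <= 2 ->
  cos x < 1 - x ^+ 2 / 2 + x ^+ 4 / 24.
Proof.
move=> x0 x2; rewrite -ltrN2; have /cvgN h := @cvg_cos_coeff' R x.
rewrite -(cvg_lim (@Rhausdorff R) h).
have -> : - (1 - x ^+ 2 / 2 + x ^+ 4 / 24) = \sum_(0 <= i < 3) - cos_coeff' x i.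
  do 3 rewrite big_nat_recl//; rewrite big_nil addr0 /cos_coeff' /=.
  rewrite !(expr0z, expr1z) fact0 /=.
  by rewrite -[(-1) ^ _]exprnP sqrrN expr1n !factS fact0 !muln1 /=; field.
rewrite -seriesN; apply: lt_sum_lim_series.
  by move/cvgP in h; rewrite seriesN.
move=> d; rewrite /cos_coeff' -!exprnP addnS -!(signr_odd _ (_ + _)) -!(signr_odd _ (_ + _).+1).
rewrite /= oddD odd_double /= expr0 expr1 mulN1r mul1r mulNr opprK subr_gt0.
set k := (3 + d.*2)%N; rewrite doubleS factS factS.
have fact_pos : (0 : R) < (k.*2)`!%:R by rewrite ltr0n fact_gt0.
have n0 : (0 : R) < (k.*2.+2 * k.*2.+1)%:R by rewrite ltr0n.
have -> : x ^+ k.*2.+2 / (k.*2.+2 * (k.*2.+1 * (k.*2)`!))%:R =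
    x ^+ k.*2 / (k.*2)`!%:R * (x ^+ 2 / (k.*2.+2 * k.*2.+1)%:R).
  rewrite mulnA natrM -[k.*2.+2 in LHS]addn2 exprD; field.
  by rewrite !gt_eqF.
rewrite gtr_pMr ?divr_gt0 ?exprn_gt0 // ltr_pdivrMr // mul1r.
apply: (@le_lt_trans _ _ (2 ^+ 2)); first by rewrite lerXn2r // nnegrE ltW.
by rewrite -natrX ltr_nat /k; lia.
Qed.

(** The Taylor bound is already negative at [8 / 5], which thus lies beyond the zero [pi / 2]. *)
Lemma pi_lt16_5 (R : realType) : pi < 16 / 5 :> R.
Proof.
have neg : cos (8 / 5 : R) < 0.
  by apply: lt_trans (cos_lt_taylor4 _ _) _; lra.
have [_ cos0] := pihalf_02_cos_pihalf R.
rewrite ltNge; apply/negP => le; move: neg.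
have [->|ne] := eqVneq (8 / 5 : R) (pi / 2); first by rewrite cos0 ltxx.
have lt : 8 / 5 < pi / 2 :> R by rewrite lt_neqAle ne /=; lra.
by rewrite ltNge ltW // cos_gt0_pihalf // lt andbT; lra.
Qed.

(* [4 / 5] instead of [3 / 4] leaves room for the boundary terms. *)
Definition density (R : realType) (k : nat) : R :=
  (4 / 5) ^+ k / (k`!%:R * k%:R ^+ k).

(** For [k = 2 * h], this trades the quotient of factorials for [3 ^ h] when the constants are
    compared. *)
Lemma fact_double_lb h : (2 <= h)%N -> (3 ^ h * h`! < (2 * h)`!)%N.
Proof.
elim: h => // -[|[|h]] IH // _.
have {IH} := IH isT; have := ltn0Sn h.+1; move: h.+2 => {}h h0 IH.
have -> : (2 * h.+1 = (2 * h).+2)%N by lia.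
rewrite !factS expnS; move: IH; set a := (3 ^ h)%N; set b := h`!; set c := (2 * h)`!.
clearbody a b c => IH.
have : (3 * h.+1 * (a * b) < (2 * h).+2 * (2 * h).+1 * c)%N.
  rewrite (@leq_ltn_trans ((2 * h).+2 * (2 * h).+1 * (a * b))) ?ltn_pmul2l //.
  by rewrite leq_mul2r; apply/orP; right; nia.
lia.
Qed.

Lemma fact_doubleS_lb h : (6 ^ h * h`! <= (2 * h).+1`!)%N.
Proof.
elim: h => // h IH.
have -> : (2 * h.+1 = (2 * h).+2)%N by lia.
rewrite [(2 * h).+3`!]factS [(2 * h).+2`!]factS expnS [h.+1`!]factS.
move: IH; set a := (6 ^ h)%N; set b := h`!; set c := (2 * h).+1`!.
clearbody a b c => IH.
have : (6 * h.+1 * (a * b) <= (2 * h).+3 * (2 * h).+2 * c)%N by apply: leq_mul => //; nia.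
lia.
Qed.

Lemma pi_exp_le (R : realType) k : pi ^+ (2 * k) <= (256 / 25) ^+ k :> R.
Proof.
rewrite exprM; apply: lerXn2r; rewrite ?nnegrE ?exprn_ge0 ?pi_ge0 //.
rewrite (_ : 256 / 25 = (16 / 5) ^+ 2); last by field.
by apply: lerXn2r; rewrite ?nnegrE ?pi_ge0 // ltW ?pi_lt16_5.
Qed.

Lemma density_lt_even (R : realType) (k : nat) : (3 <= k)%N -> ~~ odd k ->
  density R k < 5 ^+ k / (12 ^+ (k %/ 2) * pi ^+ (2 * k) * ((k %/ 2)`!)%:R).
Proof.
(* The three factors on the right stand for [25 ^ h = 5 ^ k], the [3 ^ h] from the factorials, and
   [16 ^ h <= k ^ k], which holds as [k >= 4]. *)
have num : (4 / 5) ^+ 2 * 12 * (256 / 25) ^+ 2 <= 25 * 3 * 16 :> R by lra.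
move=> k3 ek; set h := (k %/ 2)%N.
have kE : k = (2 * h)%N by rewrite /h; lia.
have h2 : (2 <= h)%N by lia.
have hf : (0 : R) < h`!%:R by rewrite ltr0n fact_gt0.
have kf : (0 : R) < k`!%:R by rewrite ltr0n fact_gt0.
have kk : (0 : R) < k%:R ^+ k by rewrite exprn_gt0 // ltr0n; lia.
have p0 := pi_gt0 R.
rewrite /density ltr_pdivrMr ?mulr_gt0 // mulrAC ltr_pdivlMr ?mulr_gt0 ?exprn_gt0 //.
apply: (@le_lt_trans _ _ ((4 / 5) ^+ k * (12 ^+ h * (256 / 25) ^+ k * h`!%:R))).
  by rewrite ler_pM2l ?exprn_gt0 ?divr_gt0 // ler_pM2r // ler_pM2l ?exprn_gt0 // pi_exp_le.
have -> : (4 / 5) ^+ k * (12 ^+ h * (256 / 25) ^+ k * h`!%:R) =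
    ((4 / 5) ^+ 2 * 12 * (256 / 25) ^+ 2) ^+ h * h`!%:R :> R.
  by rewrite kE !exprM [in RHS]exprMn [in RHS]exprMn !mulrA.
apply: (@le_lt_trans _ _ ((25 * 3 * 16) ^+ h * h`!%:R)).
  by rewrite ler_pM2r // lerXn2r ?nnegrE // !mulr_ge0 ?exprn_ge0.
rewrite -!(natrM, natrX) ltr_nat.
have : (3 ^ h * h`! < k`!)%N by rewrite kE fact_double_lb.
have : (16 ^ h <= k ^ k)%N.
  by rewrite {2}kE expnM leq_exp2r; nia.
have -> : (5 ^ k = 25 ^ h)%N by rewrite kE expnM.
rewrite !expnMn => hk hf'.
rewrite -!mulnA ltn_pmul2l ?expn_gt0 // mulnCA mulnC.
by apply: (leq_ltn_trans (leq_mul (leqnn _) hk)); rewrite ltn_pmul2r // expn_gt0; lia.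
Qed.

Lemma density_lt_odd (R : realType) (k : nat) : (3 <= k)%N -> odd k ->
  density R k < 5 ^+ (k - 1) * 6
            / (12 ^+ (k %/ 2) * pi ^+ (2 * k) * ((k %/ 2)`!)%:R * k%:R).
Proof.
(* Here [6 ^ h] comes from the factorials, and [9 ^ h * k <= k ^ k] from [k >= 3]. *)
have num : (4 / 5) ^+ 2 * 12 * (256 / 25) ^+ 2 <= 25 * 6 * 9 :> R by lra.
(* The factor left over for odd [k] exceeds 6, so it is paired with one of the [h >= 1] other
   factors. *)
have num1 : 4 / 5 * (256 / 25) * ((4 / 5) ^+ 2 * 12 * (256 / 25) ^+ 2) <
    6 * (25 * 6 * 9) :> R by lra.
move=> k3 ok; set h := (k %/ 2)%N.
have kE : k = (2 * h).+1 by rewrite /h; lia.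
have h1 : (1 <= h)%N by lia.
have hf : (0 : R) < h`!%:R by rewrite ltr0n fact_gt0.
have kf : (0 : R) < k`!%:R by rewrite ltr0n fact_gt0.
have k0 : (0 : R) < k%:R by rewrite ltr0n; lia.
have kk : (0 : R) < k%:R ^+ k by rewrite exprn_gt0.
have p0 := pi_gt0 R.
rewrite /density ltr_pdivrMr ?mulr_gt0 // mulrAC ltr_pdivlMr ?mulr_gt0 ?exprn_gt0 //.
apply: (@le_lt_trans _ _ ((4 / 5) ^+ k * (12 ^+ h * (256 / 25) ^+ k * h`!%:R * k%:R))).
  rewrite ler_pM2l ?exprn_gt0 ?divr_gt0 // ler_pM2r // ler_pM2r //.
  by rewrite ler_pM2l ?exprn_gt0 // pi_exp_le.
have -> : (4 / 5) ^+ k * (12 ^+ h * (256 / 25) ^+ k * h`!%:R * k%:R) =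
    4 / 5 * (256 / 25) * ((4 / 5) ^+ 2 * 12 * (256 / 25) ^+ 2) ^+ h * (h`!%:R * k%:R) :> R.
  rewrite {1 2}kE !(exprS _ (2 * h)) !exprM [in RHS]exprMn [in RHS]exprMn.
  by move: (_ ^+ h) => x; move: (_ ^+ h) => y; move: (_ ^+ h) => z; ring.
apply: (@lt_le_trans _ _ (6 * (25 * 6 * 9) ^+ h * (h`!%:R * k%:R))).
  rewrite ltr_pM2r ?mulr_gt0 //; move: h1; case: (h) => // l _.
  rewrite !(exprS _ l) [ltLHS]mulrA [ltRHS]mulrA.
  apply: (@le_lt_trans _ _ (4 / 5 * (256 / 25) *
      ((4 / 5) ^+ 2 * 12 * (256 / 25) ^+ 2) * (25 * 6 * 9) ^+ l)).
    apply: ler_wpM2l; first by rewrite !mulr_ge0 ?exprn_ge0.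
    by apply: lerXn2r => //; rewrite nnegrE !mulr_ge0 ?exprn_ge0.
  by rewrite ltr_pM2r ?exprn_gt0.
have -> : (5 ^+ (k - 1) = 25 ^+ h :> R).
  by rewrite kE subn1 /= exprM -natrX.
rewrite -!(natrM, natrX) ler_nat.
have hf' : (6 ^ h * h`! <= k`!)%N by rewrite kE fact_doubleS_lb.
have hk : (9 ^ h * k <= k ^ k)%N.
  rewrite {3}kE expnSr leq_mul2r expnM leq_exp2r; last by lia.
  by apply/orP; right; nia.
have -> : (6 * (25 * 6 * 9) ^ h * (h`! * k) = 25 ^ h * 6 * ((6 ^ h * h`!) * (9 ^ h * k)))%N.
  by rewrite !expnMn; lia.
by rewrite leq_mul2l leq_mul ?orbT.
Qed.

(** * The asymptotic bounds *)

Lemma eventually_le_littleo (R : realType) (k : nat) (t : nat -> nat -> nat) (C : R) :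
  (exists M, forall m n, (M <= m)%N -> (M <= n)%N ->
     (t m n)%:R <= C * m%:R ^+ (2 * k) * n%:R ^+ (2 * k)) ->
  exists2 r : nat * nat -> R^o,
      r =o_min_infty (fun p => p.1%:R ^+ (2 * k) * p.2%:R ^+ (2 * k) : R^o) &
      forall m n : nat, (0 < m)%N -> (0 < n)%N ->
        (t m n)%:R <= C * m%:R ^+ (2 * k) * n%:R ^+ (2 * k) + r (m, n) :> R.
Proof.
move=> [M HM].
(* The positive part of the excess, which vanishes once both sides are at least [M]. *)
exists (fun p => Num.max 0 ((t p.1 p.2)%:R - C * p.1%:R ^+ (2 * k) * p.2%:R ^+ (2 * k))); last first.
  by move=> m n _ _; rewrite -lerBlDl le_max lexx orbT.
apply/eqoP => e e0.
exists ([set m | (M <= m)%N], [set n | (M <= n)%N]).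
  by split; apply: nbhs_infty_ge.
move=> [m n] [/= Mm Mn].
rewrite (max_idPl _) ?normr0 ?mulr_ge0 // ?(ltW e0) //.
by rewrite subr_le0 HM.
Qed.

(** The terms in [m + n] fit between [3 / 4] and the [4 / 5] of [density]; the lower power of [N]
    fits into the gap [C - density R k.+1]. *)
Lemma num_k_threshold_eventually (R : realType) (k : nat) (C : R) :
  density R k.+1 < C ->
  exists M, forall m n, (M <= m)%N -> (M <= n)%N ->
     (num_k_threshold R k.+1 m n)%:R <= C * m%:R ^+ (2 * k.+1) * n%:R ^+ (2 * k.+1).
Proof.
set K := k.+1 => dC.
pose a := (K * (4 * K + 2))%N; pose b := (K * 2 + 1 + K ^ 2)%N.
pose M0 := Num.truncn (b%:R / (C - density R K)).
exists (maxn M0.+1 (10 * a)) => m n; rewrite !geq_max => /andP[m1 m2] /andP[n1 n2].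
pose N := (m * n)%N.
have N0 : (0 < N)%N by rewrite muln_gt0; lia.
pose E := (3 * N + a * (m + n))%N.
have main : (K`! * (4 * K) ^ K * num_k_threshold R K m n <=
    N ^ K * E ^ K + K`! * (4 * K) ^ K * (b * N ^ (k + K)))%N.
  exact: num_k_threshold_main.
(* Sides of length at least [10 * a] give [5 * a * (m + n) <= N]; the resulting [16 / 5] is
   [4 * (4 / 5)]. *)
have E_le : (5 * E <= 16 * N)%N.
  have : (10 * a * m <= N)%N by rewrite /N mulnC leq_mul2l n2 orbT.
  have : (10 * a * n <= N)%N by rewrite /N leq_mul2r m2 orbT.
  rewrite /E; lia.
have gap : b%:R <= (C - density R K) * N%:R.
  rewrite mulrC -ler_pdivrMr ?subr_gt0 //.
  apply: le_trans (ltW (truncnS_gt _)) _.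
  by rewrite ler_nat (leq_trans m1) // leq_pmulr; lia.
have d0 : (0 : R) < K`!%:R * (4 * K%:R) ^+ K.
  by rewrite mulr_gt0 ?exprn_gt0 ?mulr_gt0 ?ltr0n ?fact_gt0.
have NE : N = (m * n)%N by [].
have KE : K = k.+1 by [].
clearbody b E N K.
have {E_le} E_le : E%:R <= 16 / 5 * N%:R :> R.
  move: E_le; rewrite -(ler_nat R) !natrM => E_le.
  by rewrite mulrAC ler_pdivlMr // mulrC.
move: main; rewrite -(ler_nat R) !(natrD, natrM, natrX) => main.
have dE : N%:R ^+ K * (16 / 5 * N%:R) ^+ K =
    K`!%:R * (4 * K%:R) ^+ K * (density R K * N%:R ^+ (2 * K)) :> R.
  rewrite (_ : 16 / 5 = 4 * (4 / 5)); last by field.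
  rewrite /density mul2n -addnn exprD !(exprMn _ 4) !(exprMn _ (4 * (4 / 5))) !(exprMn _ 4).
  have KK : (K%:R ^+ K : R) != 0 by rewrite expf_neq0 // pnatr_eq0 KE.
  have FK : (K`!%:R : R) != 0 by rewrite pnatr_eq0 -lt0n fact_gt0.
  by field; rewrite KK FK.
have {}main : K`!%:R * (4 * K%:R) ^+ K * (num_k_threshold R K m n)%:R <=
    N%:R ^+ K * (16 / 5 * N%:R) ^+ K
    + K`!%:R * (4 * K%:R) ^+ K * (b%:R * N%:R ^+ (k + K)) :> R.
  apply: le_trans main _; rewrite lerD2r ler_wpM2l ?exprn_ge0 //.
  by apply: lerXn2r => //; rewrite nnegrE ?mulr_ge0 ?divr_ge0.
rewrite {}dE -mulrDr ler_pM2l // in main.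
apply: le_trans main _; rewrite -mulrA -exprMn -natrM -NE.
have -> : (2 * K = (k + K).+1)%N by rewrite KE; lia.
rewrite -lerBrDl -mulrBl exprS mulrA ler_pM2r //.
by rewrite exprn_gt0 // ltr0n.
Qed.

Theorem mainTheorem2 (R : realType) (k : nat) (k_ge3 : (3 <= k)%N) :
  (~~ odd k ->
    exists2 r : nat * nat -> R^o,
      r =o_min_infty (fun p => p.1%:R ^+ (2 * k) * p.2%:R ^+ (2 * k) : R^o) &
      forall m n : nat, (0 < m)%N -> (0 < n)%N ->
        (num_k_threshold R k m n)%:R <=
          5 ^+ k / (12 ^+ (k %/ 2) * pi ^+ (2 * k) * ((k %/ 2)`!)%:R)
            * m%:R ^+ (2 * k) * n%:R ^+ (2 * k) + r (m, n) :> R) /\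
  (odd k ->
    exists2 r : nat * nat -> R^o,
      r =o_min_infty (fun p => p.1%:R ^+ (2 * k) * p.2%:R ^+ (2 * k) : R^o) &
      forall m n : nat, (0 < m)%N -> (0 < n)%N ->
        (num_k_threshold R k m n)%:R <=
          5 ^+ (k - 1) * 6
            / (12 ^+ (k %/ 2) * pi ^+ (2 * k) * ((k %/ 2)`!)%:R * k%:R)
            * m%:R ^+ (2 * k) * n%:R ^+ (2 * k) + r (m, n) :> R).
Proof.
split=> k_parity; apply: eventually_le_littleo.
  have := density_lt_even R k_ge3 k_parity.
  by case: k k_ge3 {k_parity} => // k _; exact: num_k_threshold_eventually.
have := density_lt_odd R k_ge3 k_parity.
by case: k k_ge3 {k_parity} => // k _; exact: num_k_threshold_eventually.
Qed.
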